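(* Let $\mathbb{K}$ be a field, $R=\mathbb{K}[X_1,\ldots,X_n]$, and $J \subsetneq I \subset R$ monomial ideals. Fix a variable $X_i$ and let $I^1, J^1 \subset R[Y]$ be the $1$-step polarizations of $I$ and $J$ with respect to $X_i$. Then \[ \operatorname{sdepth} I/J = \operatorname{sdepth} I^1/J^1 - 1. \]
   Context: $1$-step polarization: if $u_1,\dots,u_m$ are the minimal monomial generators of a monomial ideal $I\subset R$, its $1$-step polarization with respect to $X_i$ is the ideal $I^1\subset R[Y]$ ($Y$ a new variable) generated by $v_1,\dots,v_m$, where $v_j=\frac{Y}{X_i}u_j$ if $X_i^2\mid u_j$, and $v_j=u_j$ otherwise. Stanley depth: with the fine multigrading, a Stanley decomposition of a finitely generated multigraded module $M$ is a finite family $(\mathbb{K}[Z_k], m_k)$ with $m_k$ homogeneous, $Z_k$ subsets of the variables, $m_k\mathbb{K}[Z_k]$ free over $\mathbb{K}[Z_k]$, and $M=\bigoplus_k m_k\mathbb{K}[Z_k]$ as multigraded $\mathbb{K}$-vector spaces; its depth is $\min_k|Z_k|$, and $\operatorname{sdepth}M$ is the maximal depth of a Stanley decomposition. *)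

(* Defs.v *)
From mathcomp Require Import all_boot all_order all_algebra.
From mathcomp Require Import mpoly.
From Stdlib Require Import ClassicalEpsilon.

Set Implicit Arguments.
Unset Strict Implicit.
Unset Printing Implicit Defensive.

Import GRing.Theory.
Local Open Scope ring_scope.

Section Defs.
Variables (K : fieldType) (n : nat).

Definition psubset := {mpoly K[n]} -> Prop.

Definition ideal_gen (S : psubset) : psubset :=
  fun f => exists r : seq ({mpoly K[n]} * {mpoly K[n]}),
    (forall p, p \in r -> S p.2) /\ f = \sum_(p <- r) p.1 * p.2.

Definition monset (s : seq 'X_{1..n}) : psubset :=
  fun p => exists2 m, m \in s & p = 'X_[m].

Definition monomial_ideal (I : psubset) : Prop :=
  exists s : seq 'X_{1..n}, forall f, I f <-> ideal_gen (monset s) f.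

Definition min_mon_gen (I : psubset) (m : 'X_{1..n}) : Prop :=
  I 'X_[m] /\ forall m', I 'X_[m'] -> (m' <= m)%MM -> m' = m.

Definition in_subring (Z : {set 'I_n}) (g : {mpoly K[n]}) : Prop :=
  forall m, m \in msupp g -> forall j, j \notin Z -> m j = 0%N.

(* A Stanley decomposition of the multigraded module I/J (J subset of I),
   given as a finite family D = [(m_k, Z_k)]_k; elements of I/J are
   represented by elements of I, and "= 0 in I/J" means "lies in J". *)
Definition stanley_decomposition (I J : psubset)
    (D : seq ({mpoly K[n]} * {set 'I_n})) : Prop :=
  let N := size D in
  let mk k := (nth (0, set0) D k).1 in
  let Zk k := (nth (0, set0) D k).2 in
  (* each m_k is a homogeneous element of I/J (fine multigrading) *)
  (forall k, (k < N)%N ->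
     I (mk k) /\ exists (c : K) (a : 'X_{1..n}), J (mk k - c *: 'X_[a])) /\
  (* m_k K[Z_k] is free over K[Z_k] *)
  (forall k, (k < N)%N -> forall g, in_subring (Zk k) g ->
     J (mk k * g) -> g = 0) /\
  (forall f, I f -> exists gs : nat -> {mpoly K[n]},
     (forall k, (k < N)%N -> in_subring (Zk k) (gs k)) /\
     J (f - \sum_(k < N) mk k * gs k)) /\
  (forall gs : nat -> {mpoly K[n]},
     (forall k, (k < N)%N -> in_subring (Zk k) (gs k)) ->
     J (\sum_(k < N) mk k * gs k) ->
     forall k, (k < N)%N -> J (mk k * gs k)).

Definition depth_ge (D : seq ({mpoly K[n]} * {set 'I_n})) (d : nat) : Prop :=
  forall p, p \in D -> (d <= #|p.2|)%N.

Definition has_sdecomp_ge (I J : psubset) (d : nat) : bool :=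
  if excluded_middle_informative
       (exists D, stanley_decomposition I J D /\ depth_ge D d)
  then true else false.

(* sdepth I/J: maximal depth of a Stanley decomposition
   (depths are at most n, the number of variables) *)
Definition sdepth (I J : psubset) : nat :=
  \max_(d < n.+1 | has_sdecomp_ge I J d) d.

End Defs.

Section Polarization.
Variables (K : fieldType) (n : nat).

(* R[Y] = {mpoly K[n.+1]}: variable X_j is index widen j, Y is index ord_max.
   polmon i u = (Y / X_i) u if X_i^2 | u, and u otherwise. *)
Definition polmon (i : 'I_n) (u : 'X_{1..n}) : 'X_{1..n.+1} :=
  [multinom (match unlift ord_max j with
              | Some k => if (k == i) && (1 < u k)%N then (u k).-1 else u k
              | None => if (1 < u i)%N then 1%N else 0%N
              end) | j < n.+1].

Definition polarization (i : 'I_n) (I : psubset K n) : psubset K n.+1 :=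
  ideal_gen (fun p => exists2 u, min_mon_gen I u & p = 'X_[polmon i u]).

End Polarization.

(* Main.v *)
(** A Stanley decomposition of [I/J] is the same as a finite partition of the
    monomials of [I] outside [J] into cones [a + N^Z].  Writing exponents of
    [R[Y]] as [(c, x, y)], with [x], [y] the exponents of [X_i] and [Y], a
    monomial lies in [I^1] iff [(c, phi x y)] lies in [I], where [phi 0 y = 0],
    [phi x 0 = 1] and [phi x y = x + 1] otherwise; the same holds for [J].

    The preimage under [phi] of a cone is a cone with one more free variable, so
    a partition for [I/J] of depth [d] gives one for [I^1/J^1] of depth [d + 1].
    Conversely, for [y] larger than every apex of a given partition for
    [I^1/J^1], the map [0 |-> (0, 0)], [1 |-> (1, 0)], [t |-> (t - 1, y)] is a
    section of [phi] along which each cone pulls back to a finite disjoint union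
    of cones having at most one free variable less. *)

Require Import Defs.
From mathcomp Require Import all_boot all_order all_algebra.
From mathcomp Require Import mpoly zify.
From Stdlib Require Import ClassicalEpsilon.

Set Implicit Arguments.
Unset Strict Implicit.
Unset Printing Implicit Defensive.

Import GRing.Theory.

(* Innermost conditionals first, so that no hypothesis retains an [if], which
   [lia] would treat as opaque. *)
Ltac lia_ifs :=
  repeat match goal with
  | |- context [if ?b then _ else _] =>
      lazymatch b with
      | context [if _ then _ else _] => fail
      | _ => let E := fresh in destruct b eqn:E
      end
  end; lia.

(** * Cones of monomials *)

Definition in_ray (z : bool) (a b : nat) : bool := (a <= b) && (z || (b == a)).

Definition in_cone {n} (p : 'X_{1..n} * {set 'I_n}) (b : 'X_{1..n}) : bool :=
  [forall j, in_ray (j \in p.2) (p.1 j) (b j)].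

(** Counting cones with multiplicity encodes covering, disjointness and avoidance of the complement
    of [P] in one equation, since [P b] is 0 or 1. *)
Definition cone_partition n (P : pred 'X_{1..n})
    (C : seq ('X_{1..n} * {set 'I_n})) : Prop :=
  forall b, count (in_cone^~ b) C = P b.

Definition dim_ge n (C : seq ('X_{1..n} * {set 'I_n})) (d : nat) : Prop :=
  forall p, p \in C -> d <= #|p.2|.

Lemma in_coneP n (p : 'X_{1..n} * {set 'I_n}) b :
  reflect ((p.1 <= b)%MM /\ forall j, j \notin p.2 -> b j = p.1 j)
          (in_cone p b).
Proof.
apply: (iffP forallP) => [H|[/mnm_lepP le_ab H] j].
  split=> [|j jZ]; first by apply/mnm_lepP => j; have /andP[] := H j.
  by have /andP[_] := H j; rewrite (negPf jZ) => /eqP.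
rewrite /in_ray le_ab /=; case: (boolP (j \in p.2)) => //= jZ.
by rewrite H.
Qed.

Lemma in_cone_apex n (p : 'X_{1..n} * {set 'I_n}) : in_cone p p.1.
Proof. by apply/forallP => j; rewrite /in_ray leqnn eqxx orbT. Qed.

Lemma forall_splitD1 (T : finType) (i : T) (P : pred T) :
  [forall k, P k] = P i && [forall k, (k != i) ==> P k].
Proof.
apply/forallP/andP => [H|[Pi /forallP H] k].
  by split=> //; apply/forallP => k; rewrite H implybT.
by have := H k; case: eqVneq => [->|].
Qed.

Lemma forall_split_max n (P : pred 'I_n.+1) :
  [forall k, P k] = P ord_max && [forall k, P (lift ord_max k)].
Proof.
apply/forallP/andP => [H|[Pi /forallP H] k]; last by case: (unliftP ord_max k) => [j|] ->.
by split=> //; apply/forallP.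
Qed.

(** Preimages respect multiplicities, so the lists obtained from single cones can be concatenated.
    It serves both directions, with [f] equal to [depol] and to its section. *)
Lemma cone_pullback n m (f : 'X_{1..m} -> 'X_{1..n}) d C :
  (forall p, p \in C ->
     exists2 L, forall b, count (in_cone^~ b) L = in_cone p (f b) & dim_ge L d) ->
  exists2 C', forall b, count (in_cone^~ b) C' = count (in_cone^~ (f b)) C
            & dim_ge C' d.
Proof.
elim: C => [_|p C IH H]; first by exists [::].
have [L cntL dL] := H p (mem_head _ _).
have [|C' cntC' dC'] := IH; first by move=> q qC; apply: H; rewrite inE qC orbT.
exists (L ++ C') => [b|q]; first by rewrite count_cat cntL cntC'.
by rewrite mem_cat => /orP[/dL|/dC'].
Qed.

Definition truncate_mon n (N : nat) (b : 'X_{1..n}) : 'X_{1..n} :=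
  [multinom minn (b j) N | j < n].

(** The finitely many fibres of truncation at [N] are cones: a coordinate truncated to [N] is free,
    a smaller one is fixed. The predicate is constant on each fibre. *)
Lemma cone_partition_exists n (P : pred 'X_{1..n}) (N : nat) :
  (forall b, P (truncate_mon N b) = P b) -> exists C, cone_partition P C.
Proof.
move=> HP.
pose mon (f : {ffun 'I_n -> 'I_N.+1}) := [multinom (f j : nat) | j < n].
pose cone f := (mon f, [set j | f j == ord_max]).
exists [seq cone f | f <- enum {ffun 'I_n -> 'I_N.+1} & P (mon f)] => b.
pose fb : {ffun 'I_n -> 'I_N.+1} := [ffun j => inord (minn (b j) N)].
have fbE j : fb j = minn (b j) N :> nat by rewrite ffunE inordK // ltnS geq_minr.
have mon_fb : mon fb = truncate_mon N b by apply/mnmP => j; rewrite !mnmE fbE.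
have coneE f : in_cone (cone f) b = (f == fb).
  apply/forallP/eqP => [H|-> j]; last first.
    rewrite /in_ray /= inE -val_eqE /= mnmE fbE; lia.
  apply/ffunP => j; apply/val_inj; rewrite /= fbE.
  have := H j; have := ltn_ord (f j).
  rewrite /in_ray /= inE -val_eqE /= mnmE; lia.
rewrite count_map count_filter.
under eq_count => f do rewrite /= coneE.
rewrite -(HP b) -mon_fb; case Pfb: (P _).
  rewrite (@eq_count _ _ (pred1 fb)) ?count_uniq_mem ?enum_uniq ?mem_enum // => f /=.
  by case: eqVneq => // ->.
rewrite (@eq_count _ _ pred0) ?count_pred0 // => f /=.
by case: eqVneq => // ->.
Qed.

(** * Exponents under one-step polarization *)

Section Depolarization.
Variables (n : nat) (i : 'I_n).

(* The largest exponent [u] with [polmon i u <= m]. *)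
Definition depol (m : 'X_{1..n.+1}) : 'X_{1..n} :=
  [multinom if j == i then
              if m (lift ord_max i) == 0 then 0
              else if m ord_max == 0 then 1 else (m (lift ord_max i)).+1
            else m (lift ord_max j) | j < n].

(* [polmon i] is the case [y = 1]. *)
Definition depol_section (y : nat) (u : 'X_{1..n}) : 'X_{1..n.+1} :=
  [multinom (match unlift ord_max j with
              | Some k => if (k == i) && (1 < u k) then (u k).-1 else u k
              | None => if 1 < u i then y else 0
              end) | j < n.+1].

Lemma depol_section_lift y u k : depol_section y u (lift ord_max k) =
  if (k == i) && (1 < u k) then (u k).-1 else u k.
Proof. by rewrite mnmE liftK. Qed.

Lemma depol_section_max y u :
  depol_section y u ord_max = if 1 < u i then y else 0.
Proof. by rewrite mnmE unlift_none. Qed.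

Lemma polmonE u : polmon i u = depol_section 1 u.
Proof. by []. Qed.

(** Positivity of [y] matters: at [y = 0] every exponent [t > 1] would come back as 1. *)
Lemma depol_sectionK y : 0 < y -> cancel (depol_section y) depol.
Proof.
move=> y_gt0 u; apply/mnmP => j; rewrite mnmE !depol_section_lift depol_section_max.
by case: eqVneq => [->|] //=; rewrite ?eqxx /=; lia_ifs.
Qed.

(** A Galois connection: [polmon i] is the lower adjoint of [depol]. Divisibility by polarized
    generators thus becomes divisibility of the depolarized monomial by the original ones. *)
Lemma polmon_le u m : (polmon i u <= m)%MM = (u <= depol m)%MM.
Proof.
rewrite polmonE; apply/mnm_lepP/mnm_lepP => H j.
  have := H (lift ord_max j); have := H ord_max.
  rewrite depol_section_lift depol_section_max mnmE.
  by case: eqVneq => [->|] //=; lia_ifs.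
case: (unliftP ord_max j) => [k|] ->.
  rewrite depol_section_lift; have := H k; rewrite mnmE.
  by case: eqVneq => [->|] //=; lia_ifs.
by rewrite depol_section_max; have := H i; rewrite mnmE eqxx; lia_ifs.
Qed.

Lemma depol_mono m m' : (m <= m')%MM -> (depol m <= depol m')%MM.
Proof. by move=> le_m; rewrite -polmon_le (lepm_trans _ le_m) // polmon_le lepm_refl. Qed.

Lemma cone_depol (p : 'X_{1..n} * {set 'I_n}) :
  exists2 q, forall m, in_cone q m = in_cone p (depol m) & #|q.2| = #|p.2|.+1.
Proof.
case: p => a Z /=; set x := lift ord_max i.
(* The fibre of [depol] over 1 is the ray [x >= 1, y = 0]; over any other
   exponent it is a ray in the direction [y]. *)
pose v := if (i \notin Z) && (a i == 1) then x else ord_max.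
have maxNlift : ord_max \notin lift ord_max @: Z.
  by apply/imsetP => -[k _ /eqP]; rewrite (negPf (neq_lift _ _)).
have lift_in k : (lift ord_max k \in lift ord_max @: Z) = (k \in Z).
  by rewrite mem_imset //; apply: lift_inj.
(* By the adjunction, [polmon i a] is the least monomial whose image under [depol] is a multiple of
   [a]. *)
exists (polmon i a, v |: (lift ord_max @: Z)) => [m|]; last first.
  rewrite cardsU1 card_imset; last exact: lift_inj.
  rewrite /v; case: ifP => [/andP[iZ _]|_]; last by rewrite maxNlift.
  by rewrite /x lift_in iZ.
rewrite /in_cone forall_split_max (forall_splitD1 i) [RHS](forall_splitD1 i).
rewrite andbA /=; congr (_ && _).
  rewrite polmonE depol_section_max depol_section_lift eqxx !inE lift_in.
  rewrite (negPf maxNlift) mnmE eqxx /in_ray /v -/x.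
  have xNmax : (x == ord_max) = false by rewrite eq_sym (negPf (neq_lift _ _)).
  case: (i \in Z) => /=; rewrite ?eqxx ?xNmax ?[ord_max == x]eq_sym ?xNmax /=.
    by lia_ifs.
  by case: (eqVneq (a i) 1) => a1;
    rewrite ?eqxx ?xNmax ?[ord_max == x]eq_sym ?xNmax /=; lia_ifs.
apply: eq_forallb => k; case: eqVneq => //= kNi.
rewrite polmonE depol_section_lift mnmE (negPf kNi) /= !inE lift_in; congr in_ray.
rewrite /v; case: ifP => _; last by rewrite eq_sym (negPf (neq_lift _ _)).
by rewrite (inj_eq lift_inj) (negPf kNi).
Qed.

Lemma card_lift_preim (Z : {set 'I_n.+1}) :
  #|Z| = (ord_max \in Z) + ((lift ord_max i \in Z)
         + #|[set k | (lift ord_max k \in Z) && (k != i)]|).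
Proof.
rewrite (cardsD1 ord_max); congr (_ + _).
have -> : Z :\ ord_max = lift ord_max @: [set k | lift ord_max k \in Z].
  apply/setP => j; apply/idP/imsetP => [|[k]]; last first.
    by rewrite !inE => kZ ->; rewrite eq_sym neq_lift.
  rewrite !inE; case: (unliftP ord_max j) => [k|] ->; rewrite ?eqxx // => /andP[_ kZ].
  by exists k; rewrite ?inE.
rewrite card_imset; last exact: lift_inj.
rewrite (cardsD1 i) inE; congr (_ + _); apply: eq_card => k.
by rewrite !inE andbC.
Qed.

(** In the plane of [X_i] and [Y] the section runs through (0,0), (1,0), then (t-1,y). If the cone
    is free in both directions, it meets this path in a final segment; otherwise it meets it in
    finitely many points. The bound on the apex excludes all t > 1 when [Y] is fixed. *)
Lemma cone_depol_section y (p : 'X_{1..n.+1} * {set 'I_n.+1}) :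
  p.1 ord_max < y ->
  exists2 L, forall b, count (in_cone^~ b) L = in_cone p (depol_section y b)
           & dim_ge L #|p.2|.-1.
Proof.
case: p => a Z /= ay_lt; set x := lift ord_max i.
pose Z0 := [set k | (lift ord_max k \in Z) && (k != i)].
pose sub t := [multinom if k == i then t else a (lift ord_max k) | k < n].
pose rest b := [forall k, (k != i) ==>
   in_ray (lift ord_max k \in Z) (a (lift ord_max k)) (b k)].
(* [test] is the condition in the two coordinates [X_i] and [Y]; [rest] collects all other
   coordinates, which the section leaves unchanged. *)
pose test t := in_ray (ord_max \in Z) (a ord_max) (if 1 < t then y else 0)
            && in_ray (x \in Z) (a x) (if 1 < t then t.-1 else t).
have coneE b : in_cone (a, Z) (depol_section y b) = test (b i) && rest b.
  rewrite /in_cone forall_split_max (forall_splitD1 i) andbA /=; congr (_ && _).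
    by rewrite depol_section_max depol_section_lift eqxx.
  by apply: eq_forallb => k; rewrite depol_section_lift; case: eqVneq.
have subE t W b : W \in [:: Z0; i |: Z0] ->
    in_cone (sub t, W) b = in_ray (i \in W) t (b i) && rest b.
  move=> HW; rewrite /in_cone (forall_splitD1 i) /= mnmE eqxx; congr (_ && _).
  apply: eq_forallb => k; case: eqVneq => //= kNi; rewrite mnmE (negPf kNi).
  by case/predU1P: HW => [->|/predU1P[->|//]]; rewrite !inE kNi ?andbT ?(negPf kNi).
have iNZ0 : i \notin Z0 by rewrite inE eqxx andbF.
have cardZ : #|Z| = (ord_max \in Z) + ((x \in Z) + #|Z0|) by apply: card_lift_preim.
have [/andP[xZ yZ]|xyNZ] := boolP ((x \in Z) && (ord_max \in Z)).
  (* The first parameter on the path lying above the apex: a positive [Y]-exponent forces t > 1, and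
     from there on t - 1 must reach [a x]. *)
  pose t0 := if a ord_max == 0 then if a x <= 1 then a x else (a x).+1
             else (maxn (a x) 1).+1.
  exists [:: (sub t0, i |: Z0)] => [b|q]; last first.
    by rewrite inE => /eqP -> /=; rewrite cardsU1 iNZ0 cardZ xZ yZ.
  rewrite /= addn0 coneE subE ?inE ?eqxx ?orbT //; congr (nat_of_bool (_ && _)).
  rewrite /test xZ yZ /in_ray /= /t0; lia_ifs.
(* One cone for each admissible t, with exponent t of [X_i] fixed. At most one of the two directions
   was free, so at most one free variable is lost. *)
exists [seq (sub t, Z0) | t <- iota 0 (a x).+2 & test t] => [b|q]; last first.
  case/mapP => t _ -> /=; rewrite cardZ; move: xyNZ (#|Z0|) => + c.
  by case: (x \in Z); case: (ord_max \in Z) => //= _; lia.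
rewrite count_map count_filter coneE.
have test_lt t : test t -> t < (a x).+2.
  move: xyNZ; rewrite /test /in_ray; case: (x \in Z); case: (ord_max \in Z) => //=; lia_ifs.
have Z0in : Z0 \in [:: Z0; i |: Z0] by rewrite mem_head.
under eq_count => t do rewrite /= (subE _ _ _ Z0in) (negPf iNZ0).
case Tb: (_ && _).
  case/andP: Tb => Tb Rb.
  rewrite (@eq_count _ _ (pred1 (b i))) => [|t /=].
    by rewrite count_uniq_mem ?iota_uniq // mem_iota test_lt.
  rewrite Rb /in_ray /=; have [->|tNb] := eqVneq t (b i); first by rewrite Tb; lia.
  by apply/negbTE; lia.
rewrite (@eq_count _ _ pred0) ?count_pred0 // => t /=.
apply: contraFF Tb => /andP[/andP[rt ->] Tt]; rewrite andbT.
by have -> : b i = t by move: rt; rewrite /in_ray; lia.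
Qed.

End Depolarization.

Lemma cone_partition_depol n (i : 'I_n) (P : pred 'X_{1..n}) C d :
  cone_partition P C -> dim_ge C d ->
  exists2 C', cone_partition (P \o depol i) C' & dim_ge C' d.+1.
Proof.
move=> PC dC; have [|C' cntC' dC'] := @cone_pullback _ _ (depol i) d.+1 C.
  move=> p pC; have [q qE dq] := cone_depol i p.
  exists [:: q] => [b|r]; first by rewrite /= addn0 qE.
  by rewrite inE => /eqP ->; rewrite dq ltnS dC.
by exists C' => // b; rewrite cntC' PC.
Qed.

(* Choosing [y] beyond every apex keeps cones that are free in [x] but not in
   [y] from meeting the section in infinitely many points. *)
Lemma cone_partition_undepol n (i : 'I_n) (P : pred 'X_{1..n}) C d :
  cone_partition (P \o depol i) C -> dim_ge C d.+1 ->
  exists2 C', cone_partition P C' & dim_ge C' d.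
Proof.
move=> PC dC; pose y := (\max_(p <- C) p.1 ord_max).+1.
have [|C' cntC' dC'] := @cone_pullback _ _ (depol_section i y) d C.
  move=> p pC; have [|L cntL dL] := @cone_depol_section _ i y p.
    by rewrite ltnS (leq_bigmax_seq p).
  by exists L => // q /dL; apply: leq_trans; rewrite -ltnS (leq_trans (dC p pC)) ?leqSpred.
by exists C' => // b; rewrite cntC' PC /= depol_sectionK.
Qed.

(** * Monomial ideals and Stanley decompositions *)

Section MonomialIdeals.
Variables (K : fieldType) (n : nat).
Implicit Types (I J : psubset K n) (U V : pred 'X_{1..n}) (f g : {mpoly K[n]}).

Lemma ideal_gen_monP (S : 'X_{1..n} -> Prop) f :
  ideal_gen (fun p => exists2 u, S u & p = 'X_[u]) f <->
  (forall m, m \in msupp f -> exists2 u, S u & (u <= m)%MM).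
Proof.
split=> [[r [Sr ->]] m /msupp_sum_le /flattenP[_ /mapP[p + ->]]|].
  rewrite filter_predT => /Sr[u Su ->] /msuppM_le /allpairsP[[m1 m2] /= [_]].
  by rewrite msuppX inE => /eqP -> ->; exists u => //; apply: lem_addl.
rewrite [X in ideal_gen _ X]mpolyE; elim: (msupp f) => [_|m s IH Hs].
  by exists [::]; split=> //; rewrite !big_nil.
have [|r [Sr E]] := IH; first by move=> m' m's; apply: Hs; rewrite inE m's orbT.
have [u Su le_um] := Hs m (mem_head _ _).
exists (((f@_m)%R *: 'X_[m - u], 'X_[u])%R :: r); split=> [p|].
  by rewrite inE => /predU1P[-> /=|/Sr //]; exists u.
by rewrite !big_cons E /= -scalerAl -mpolyXD submK.
Qed.

Definition up_closed U : Prop := forall a b, (a <= b)%MM -> U a -> U b.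

(** Replaces an ideal by the boolean set of its exponents, so that membership is tested monomial by
    monomial. *)
Definition spanned_by I U : Prop :=
  forall f, I f <-> {in msupp f, forall m, U m}.

Lemma spanned_byX I U m : spanned_by I U -> I 'X_[m]%R <-> U m.
Proof.
move=> IU; split=> [/IU H|Um]; first by apply: H; rewrite msuppX inE.
by apply/IU => m'; rewrite msuppX inE => /eqP ->.
Qed.

Lemma spanned_byM I U f g : spanned_by I U -> up_closed U -> I f -> I (f * g)%R.
Proof.
move=> IU upU /IU If; apply/IU => m /msuppM_le /allpairsP[[m1 m2] /= [/If U1 _ ->]].
exact: upU (lem_addr _ _) U1.
Qed.

Lemma spanned_by_coef0 I U f m : spanned_by I U -> I f -> ~~ U m -> (f@_m = 0)%R.
Proof.
move=> IU /IU If; apply: contraNeq; rewrite -mcoeff_msupp; exact: If.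
Qed.

Lemma monomial_ideal_spanned I : monomial_ideal I ->
  exists U N, [/\ spanned_by I U, up_closed U
    & forall N' b, N <= N' -> U (truncate_mon N' b) = U b].
Proof.
case=> s Is; exists (fun m => has (fun u => (u <= m)%MM) s).
(* The largest degree bounds every exponent of every generator, so truncation there does not affect
   divisibility by generators. *)
exists (\max_(u <- s) mdeg u); split.
- move=> f; rewrite Is (ideal_gen_monP (fun u => u \in s)).
  split=> H m /H; first by case=> u us le_um; apply/hasP; exists u.
  by case/hasP=> u us le_um; exists u.
- move=> a b le_ab /hasP[u us le_ua]; apply/hasP; exists u => //.
  exact: lepm_trans le_ua le_ab.
move=> N' b leN; apply: eq_in_has => u us; apply/mnm_lepP/mnm_lepP => H j.
  by have := H j; rewrite mnmE leq_min => /andP[].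
rewrite mnmE leq_min H /=; apply: leq_trans leN.
apply: leq_trans (leq_bigmax_seq u us isT).
by rewrite mdegE (bigD1 j) //= leq_addr.
Qed.

Lemma min_mon_gen_exists I U m : spanned_by I U -> U m ->
  exists2 u, min_mon_gen I u & (u <= m)%MM.
Proof.
move=> IU; have [k] := ubnP (mdeg m); elim: k m => // k IH m lt_mk Um.
have [|nmin] := excluded_middle_informative (min_mon_gen I m).
  by exists m => //; apply: lepm_refl.
have [[m' [Im' le_m' neq_m']]|nex] := excluded_middle_informative
    (exists m', [/\ I 'X_[m']%R, (m' <= m)%MM & m' <> m]).
  have [||u uI le_u] := IH m'; last by exists u => //; apply: lepm_trans le_u le_m'.
    move/submK: (le_m') => E; rewrite -E mdegD in lt_mk.
    suff : mdeg (m - m') != 0 by lia.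
    rewrite mdeg_eq0; apply/eqP => Z; apply: neq_m'.
    by rewrite -E Z add0m.
  exact/(spanned_byX m' IU).
case: nmin; split; first exact/(spanned_byX m IU).
move=> m' Im' le_m'; have [//|/eqP neq] := eqVneq m' m.
by case: nex; exists m'.
Qed.

Lemma in_cone_supp (p : 'X_{1..n} * {set 'I_n}) g m :
  in_subring p.2 g -> (('X_[p.1] * g)@_m)%R != 0%R -> in_cone p m.
Proof.
move=> gZ; rewrite -mcoeff_msupp => /msuppM_le /allpairsP[[m1 m2] /= [+ m2g ->]].
rewrite msuppX inE => /eqP ->; apply/in_coneP; split; first exact: lem_addr.
by move=> j jZ; rewrite mnmDE (gZ _ m2g _ jZ) addn0.
Qed.

Lemma in_cone_sub (p : 'X_{1..n} * {set 'I_n}) m :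
  in_cone p m -> in_subring p.2 ('X_[m - p.1] : {mpoly K[n]})%R.
Proof.
case/in_coneP => le_am eq_am m'; rewrite msuppX inE => /eqP -> j jZ.
by rewrite mnmBE eq_am // subnn.
Qed.

Lemma mulX_sub (a m : 'X_{1..n}) :
  (a <= m)%MM -> ('X_[a] * 'X_[m - a] = 'X_[m] :> {mpoly K[n]})%R.
Proof. by move=> le_am; rewrite -mpolyXD addmC submK. Qed.

(** The part of [f] supported in a cone is a multiple of the apex by an element of the corresponding
    subring. *)
Lemma cone_part (p : 'X_{1..n} * {set 'I_n}) f : exists2 g, in_subring p.2 g &
  forall m, (('X_[p.1] * g)@_m = f@_m *+ in_cone p m)%R.
Proof.
exists (\sum_(m <- msupp f | in_cone p m) f@_m *: 'X_[m - p.1])%R => [m|m].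
  move=> /msupp_sum_le /flattenP[_ /mapP[m' + ->]].
  by rewrite mem_filter => /andP[pm' _] /msuppZ_le; apply: in_cone_sub.
rewrite mulr_sumr raddf_sum /=.
under eq_bigr => m' /in_coneP[le_am' _]
  do rewrite -scalerAr mulX_sub // mcoeffZ mcoeffX.
have [mf|mNf] := boolP (m \in msupp f); last first.
  rewrite big1_seq ?(memN_msupp_eq0 mNf) ?mul0rn // => m' /andP[_ m'f].
  by case: eqVneq m'f => [->|_ _]; rewrite ?(negPf mNf) // mulr0.
rewrite big_mkcond (bigD1_seq m) ?msupp_uniq //= big1 => [|m' neq].
  by rewrite eqxx mulr1 addr0; case: ifP.
by rewrite (negPf neq) mulr0 if_same.
Qed.

(** Splitting [f] along the cones counts each monomial as often as cones contain it: once in [U]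
    outside [V], never elsewhere. *)
Lemma stanley_of_cone_partition I J U V C :
  spanned_by I U -> spanned_by J V ->
  cone_partition [pred b | U b && ~~ V b] C ->
  stanley_decomposition I J [seq ('X_[p.1], p.2)%R | p <- C].
Proof.
move=> IU JV PC; pose p0 : 'X_{1..n} * {set 'I_n} := (0%MM, set0).
pose q k := nth p0 C k; rewrite /stanley_decomposition size_map.
have nthE k : k < size C ->
    nth (0%R, set0) [seq ('X_[p.1] : {mpoly K[n]}, p.2)%R | p <- C] k
    = ('X_[(q k).1], (q k).2)%R.
  by move=> ltk; rewrite (nth_map p0).
have coneP k b : k < size C -> in_cone (q k) b -> U b && ~~ V b.
  move=> ltk kb; rewrite -[_ && _]lt0b -(PC b) -has_count.
  by apply/hasP; exists (q k) => //; apply: mem_nth.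
have count_sum b : count (in_cone^~ b) C = \sum_(k < size C) in_cone (q k) b.
  by rewrite -sum1_count big_mkcond (big_nth p0) big_mkord; apply: eq_bigr => k _; case: ifP.
have free k g : k < size C -> in_subring (q k).2 g -> J ('X_[(q k).1] * g)%R -> g = 0%R.
  move=> ltk gZ Jg; apply/mpolyP => m; rewrite mcoeff0.
  have [//|gm] := eqVneq (g@_m)%R 0%R.
  (* A coefficient of [g] reappears at a monomial of the cone, hence outside [V], where elements of
     [J] have coefficient 0. *)
  have E : (('X_[(q k).1] * g)@_((q k).1 + m) = g@_m)%R by rewrite mulrC mcoeffMX.
  have /(coneP _ _ ltk)/andP[_ nV] : in_cone (q k) ((q k).1 + m)%MM.
    by apply: (in_cone_supp gZ); rewrite E.
  by rewrite -E; apply: spanned_by_coef0 JV Jg nV.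
split; [|split; [|split]].
- move=> k ltk; rewrite nthE //=; split.
    by apply/(spanned_byX _ IU); have /andP[] := coneP k _ ltk (in_cone_apex (q k)).
  exists 1%R, (q k).1; rewrite scale1r subrr; apply/JV => m.
  by rewrite msupp0.
- by move=> k ltk g; rewrite nthE //=; apply: free.
- move=> f If.
  have Hpart (k : 'I_(size C)) : exists g, in_subring (q k).2 g /\
      forall m, (('X_[(q k).1] * g)@_m = f@_m *+ in_cone (q k) m)%R.
    by have [g gZ gE] := cone_part (q k) f; exists g.
  have [gs Hgs] := fin_all_exists Hpart.
  exists (fun k => if insub k is Some k' then gs k' else 0%R); split.
    move=> k ltk; rewrite nthE //= insubT /=; exact: (Hgs (Ordinal ltk)).1.
  apply/JV => m; rewrite mcoeff_msupp mcoeffB raddf_sum /=.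
  under eq_bigr => k _ do rewrite nthE //= valK (Hgs k).2.
  rewrite sumrMnr -count_sum PC /=; case: (V m); rewrite // andbT.
  case Um: (U m); rewrite ?mulr1n ?subrr ?eqxx // mulr0n subr0.
  by rewrite (spanned_by_coef0 IU If) ?Um ?eqxx.
move=> gs gsZ /JV Js k ltk; rewrite nthE //=; apply/JV => m.
have gZ k' : k' < size C -> in_subring (q k').2 (gs k').
  by move=> lt'; have := gsZ k' lt'; rewrite nthE.
rewrite mcoeff_msupp => km0; have km := in_cone_supp (gZ k ltk) km0.
apply: Js; rewrite mcoeff_msupp raddf_sum /= (bigD1 (Ordinal ltk)) //= big1.
  by rewrite addr0 nthE.
move=> k' neq; rewrite nthE //=; apply/eqP; apply: contraTT isT.
move/(in_cone_supp (gZ _ (ltn_ord k'))) => k'm.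
(* A second cone through [m] would make the count at least 2, so no other summand can cancel the
   coefficient at [m]. *)
have : count (in_cone^~ m) C <= 1 by rewrite PC leq_b1.
by rewrite count_sum (bigD1 (Ordinal ltk)) //= (bigD1 k') //= km k'm !add1n.
Qed.

(** Modulo [J] each [mk k] is a scalar times a monomial, which serves as apex. Freeness keeps the
    cones off [V] and the scalars nonzero, spanning gives covering, and independence gives
    disjointness. *)
Lemma cone_partition_of_stanley I J U V D :
  spanned_by I U -> up_closed U -> spanned_by J V -> up_closed V ->
  stanley_decomposition I J D ->
  exists2 C, cone_partition [pred b | U b && ~~ V b] C
           & [seq p.2 | p <- C] = [seq p.2 | p <- D].
Proof.
move=> IU upU JV upV [mkP [free [span indep]]].
set N := size D in mkP free span indep.
pose mk k := (nth (0%R, set0) D k).1; pose Zk k := (nth (0%R, set0) D k).2.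
have Hhom (k : 'I_N) : exists ca : K * 'X_{1..n}, J (mk k - ca.1 *: 'X_[ca.2])%R.
  by have [_ [c [a Jca]]] := mkP k (ltn_ord k); exists (c, a).
have [ca Hca] := fin_all_exists Hhom.
pose p k := ((ca k).2, Zk k).
have JN f g : J f -> (J (f - g)%R <-> J g).
  move=> /JV Jf; split=> /JV Jg; apply/JV => m.
    have -> : g = (f - (f - g))%R by rewrite opprB addrCA subrr addr0.
    by move/msuppB_le; rewrite mem_cat => /orP[/Jf|/Jg].
  by move/msuppB_le; rewrite mem_cat => /orP[/Jf|/Jg].
have coefE (k : 'I_N) g m : ~~ V m ->
    ((mk k * g)@_m = (ca k).1 * ('X_[(p k).1] * g)@_m)%R.
  move=> nV; apply/eqP; rewrite -mcoeffZ scalerAl -subr_eq0 -mcoeffB -mulrBl.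
  by apply/eqP/(spanned_by_coef0 JV _ nV)/(spanned_byM _ JV upV)/Hca.
have X_neq0 m : ('X_[m] : {mpoly K[n]})%R <> 0%R.
  by move/(congr1 (mcoeff m)); rewrite mcoeffX eqxx mcoeff0 => /eqP; rewrite oner_eq0.
have cone_free (k : 'I_N) m : in_cone (p k) m -> ~ J (mk k * 'X_[m - (p k).1])%R.
  by move=> km Jm; apply: (X_neq0 (m - (p k).1)%MM);
     apply: free Jm => //; apply: (in_cone_sub km).
have cone_J (k : 'I_N) m : in_cone (p k) m ->
    J (mk k * 'X_[m - (p k).1] - (ca k).1 *: 'X_[m])%R.
  case/in_coneP=> le_am _; rewrite -(mulX_sub le_am) scalerAl -mulrBl.
  exact/(spanned_byM _ JV upV)/Hca.
have cone_nV (k : 'I_N) m : in_cone (p k) m -> ~~ V m.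
  move=> km; apply/negP => Vm; apply: (cone_free k m km).
  rewrite -[X in J X](subrK ((ca k).1 *: 'X_[m])%R); apply/JV => m'.
  move/msuppD_le; rewrite mem_cat => /orP[|/msuppZ_le].
    by apply: (JV _).1 (cone_J k m km) _.
  by rewrite msuppX inE => /eqP ->.
have cone_c (k : 'I_N) m : in_cone (p k) m -> (ca k).1 != 0%R.
  move=> km; apply/eqP => c0; apply: (cone_free k m km).
  by have := cone_J k m km; rewrite c0 scale0r subr0.
have cone_U (k : 'I_N) m : in_cone (p k) m -> U m.
  move=> km; have /in_coneP[le_am _] := km.
  have [Ik _] := mkP k (ltn_ord k).
  apply: ((IU _).1 (spanned_byM ('X_[m - (p k).1])%R IU upU Ik)).
  (* The product of [mk k] with the monomial from the apex to [m] lies in [I], and its coefficient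
     at [m] is the nonzero scalar. *)
  rewrite mcoeff_msupp coefE ?(cone_nV k) // mulX_sub // mcoeffX eqxx mulr1.
  exact: cone_c km.
exists [seq p k | k <- enum 'I_N]; last first.
  by rewrite -[in RHS](mkseq_nth (0%R, set0) D) /mkseq -val_enum_ord -!map_comp.
move=> b; rewrite count_map.
have -> : count (preim p (in_cone^~ b)) (enum 'I_N) = #|[pred k | in_cone (p k) b]|.
  by rewrite enumT cardE /enum_mem size_filter; apply: eq_count => k; rewrite inE.
rewrite -[RHS]/(nat_of_bool (U b && ~~ V b)); case UV: (_ && _); last first.
  apply: eq_card0 => k; rewrite inE; apply: contraFF UV => kb /=.
  by rewrite (cone_U k) ?(cone_nV k).
case/andP: UV => Ub nVb; apply/eqP/card1P.
have [k kb] : exists k, in_cone (p k) b.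
  case: (pickP (fun k => in_cone (p k) b)) => [k kb|none]; first by exists k.
  (* If no cone contained [b], the decomposition of the monomial [b] would have coefficient 0 there,
     against 1. *)
  have [gs [gsZ Js]] := span 'X_[b]%R ((spanned_byX b IU).2 Ub).
  have /eqP := spanned_by_coef0 JV Js nVb.
  rewrite mcoeffB mcoeffX eqxx raddf_sum big1 ?subr0 ?oner_eq0 // => k _ /=.
  rewrite [LHS](coefE k) //; apply/eqP; rewrite mulf_eq0; apply/orP; right.
  by apply/eqP; apply: contraFeq (none k); apply: in_cone_supp; apply: gsZ.
exists k => k'; rewrite !inE; apply/idP/eqP => [k'b|->//].
have [//|neq] := eqVneq k' k.
(* Scaled so that [mk l * h l] is the monomial [b] modulo [J]. If two cones share [b], the
   difference of the two products lies in [J]; independence and freeness then force [h k = 0]. *)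
pose h (l : 'I_N) : {mpoly K[n]} := ((ca l).1^-1 *: 'X_[b - (p l).1])%R.
have hZ (l : 'I_N) : in_cone (p l) b -> in_subring (Zk l) (h l).
  by move=> lb m /msuppZ_le; apply: (in_cone_sub lb).
have Jh (l : 'I_N) : in_cone (p l) b -> J (mk l * h l - 'X_[b])%R.
  move=> lb; have -> : (mk l * h l - 'X_[b] =
      (ca l).1^-1 *: (mk l * 'X_[b - (p l).1] - (ca l).1 *: 'X_[b]))%R.
    by rewrite scalerBr scalerA mulVf ?(cone_c l b) // scale1r scalerAr.
  by apply/JV => m /msuppZ_le; apply: (JV _).1 (cone_J l b lb) _.
pose gs j := (if j == k :> nat then h k else if j == k' :> nat then - h k' else 0)%R.
have gsZ j : j < N -> in_subring (Zk j) (gs j).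
  move=> _; rewrite /gs; case: eqP => [->|_]; first exact: hZ.
  case: eqP => [->|_ m]; last by rewrite msupp0.
  by move=> m; rewrite (perm_mem (msuppN _)); apply: hZ.
have Js : J (\sum_(j < N) mk j * gs j)%R.
  rewrite (bigD1 k) //= (bigD1 k') //= big1 => [|j /andP[jk jk']]; last first.
    by rewrite /gs !val_eqE (negPf jk) (negPf jk') mulr0.
  rewrite addr0 /gs eqxx val_eqE (negPf neq) eqxx mulrN.
  have -> : (mk k * h k - mk k' * h k' =
     (mk k * h k - 'X_[b]) - (mk k' * h k' - 'X_[b]))%R by rewrite opprB addrA subrK.
  by apply/JN; apply: Jh.
have /(free k (ltn_ord k)) := indep gs gsZ Js k (ltn_ord k).
move/(_ (gsZ k (ltn_ord k)))/eqP; rewrite /gs eqxx scaler_eq0 invr_eq0.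
by rewrite (negPf (cone_c k b kb)) => /eqP/X_neq0.
Qed.

Lemma has_sdecomp_geP I J U V d :
  spanned_by I U -> up_closed U -> spanned_by J V -> up_closed V ->
  has_sdecomp_ge I J d <->
  exists2 C, cone_partition [pred b | U b && ~~ V b] C & dim_ge C d.
Proof.
move=> IU upU JV upV; rewrite /has_sdecomp_ge.
case: excluded_middle_informative => [[D [SD dD]]|nD]; split=> //.
  have [C PC CD] := cone_partition_of_stanley IU upU JV upV SD.
  exists C => // p /(map_f snd); rewrite CD => /mapP[q /dD + ->]; exact.
case=> C PC dC; case: nD; exists [seq ('X_[p.1], p.2)%R | p <- C]; split.
  exact: stanley_of_cone_partition PC.
by move=> p /mapP[q /dC + ->].
Qed.

End MonomialIdeals.

(** * Polarized ideals and comparison of the two depths *)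

Lemma up_closed_depol n (i : 'I_n) (U : pred 'X_{1..n}) :
  up_closed U -> up_closed (U \o depol i).
Proof. by move=> upU a b le_ab; apply: upU; apply: depol_mono. Qed.

(** By the adjunction, a polarized minimal generator divides [m] iff the original one divides
    [depol i m]; every exponent in [U] lies above a minimal one. *)
Lemma polarization_spanned (K : fieldType) n (i : 'I_n) (I : psubset K n) U :
  spanned_by I U -> up_closed U -> spanned_by (polarization i I) (U \o depol i).
Proof.
move=> IU upU f.
have genE p : (exists2 u, min_mon_gen I u & p = 'X_[polmon i u]%R) <->
    (exists2 v, exists2 u, min_mon_gen I u & v = polmon i u & p = 'X_[v]%R).
  split=> [[u uI ->]|[_ [u uI ->] ->]]; last by exists u.
  by exists (polmon i u) => //; exists u.
have -> : polarization i I f <-> ideal_gen (fun p =>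
    exists2 v, exists2 u, min_mon_gen I u & v = polmon i u & p = 'X_[v]%R) f.
  by split=> -[r [Sr ->]]; exists r; split=> // p /Sr /genE.
rewrite ideal_gen_monP; split=> H m /H /=.
  case=> _ [u [/(spanned_byX u IU) Uu _] ->]; rewrite polmon_le => le_u.
  exact: upU le_u Uu.
case/(min_mon_gen_exists IU) => u uI le_u; exists (polmon i u); first by exists u.
by rewrite polmon_le.
Qed.

Theorem theorem4p3 (K : fieldType) (n : nat) (I J : psubset K n) (i : 'I_n) :
  monomial_ideal I -> monomial_ideal J ->
  (forall f, J f -> I f) -> (exists f, I f /\ ~ J f) ->
  ((sdepth I J)%:Z =
   (sdepth (polarization i I) (polarization i J))%:Z - 1)%R.
Proof.
move=> /monomial_ideal_spanned[U [N [IU upU truncU]]].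
move=> /monomial_ideal_spanned[V [N' [JV upV truncV]]] _ _.
have polE d := has_sdecomp_geP d
  (polarization_spanned i IU upU) (up_closed_depol (i := i) upU)
  (polarization_spanned i JV upV) (up_closed_depol (i := i) upV).
have has_pol d : has_sdecomp_ge (polarization i I) (polarization i J) d.+1 =
                 has_sdecomp_ge I J d.
  apply/idP/idP => [/polE[C PC dC]|/(has_sdecomp_geP d IU upU JV upV)[C PC dC]].
    apply/(has_sdecomp_geP d IU upU JV upV).
    exact: (cone_partition_undepol (i := i) PC dC).
  by apply/polE; exact: (cone_partition_depol i PC dC).
(* Some decomposition must exist: an empty maximum would be 0 by default on both sides and break the
   shift by one. *)
have has0 : has_sdecomp_ge I J 0.
  apply/(has_sdecomp_geP 0 IU upU JV upV).
  have [|C PC] := @cone_partition_exists n [pred b | U b && ~~ V b] (N + N').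
    by move=> b /=; rewrite truncU ?leq_addr // truncV ?leq_addl.
  by exists C.
suff -> : sdepth (polarization i I) (polarization i J) = (sdepth I J).+1.
  by rewrite -addn1 PoszD addrK.
apply/eqP; rewrite eqn_leq; apply/andP; split.
  (* Depth 0 is bounded trivially; a positive depth [d.+1] for the polarized pair comes from depth
     [d]. *)
  apply/bigmax_leqP => -[[|d] ltd] //=; rewrite has_pol => Hd.
  rewrite ltnS; exact: (@leq_bigmax_cond _ (fun d : 'I_n.+1 => has_sdecomp_ge I J d)
    (fun d : 'I_n.+1 => d : nat) (Ordinal (ltd : d < n.+1))).
have [|d Hd dE] := @eq_bigmax_cond _ [pred d : 'I_n.+1 | has_sdecomp_ge I J d]
    (fun d : 'I_n.+1 => d : nat).
  by apply/card_gt0P; exists ord0.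
have -> : sdepth I J = d by rewrite -dE.
have ltd : d.+1 < n.+2 by rewrite ltnS.
by apply: (@leq_bigmax_cond _ _ (fun d : 'I_n.+2 => d : nat) (Ordinal ltd)); rewrite /= has_pol.
Qed.
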